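(* (Strong Adequacy) For every $(n,k)\in\omega^2$ and every $\Gamma\cup\{\phi\}\subseteq L(C)$: $\Gamma\models_{(n,k)}\phi$ if and only if $\Gamma\vdash_{(n,k)}\phi$.
   Context: $\omega=\{0,1,2,\dots\}$. Let $\mathcal V$ be a countable set of atomic formulas, and let $L(C)$ be the set of formulas freely generated from $\mathcal V$ by the connectives $C=\{\neg,\rightarrow\}$ ($\neg$ unary, $\rightarrow$ binary). Semantics. For $(n,k)\in\omega^2$, the matrix $M_{(n,k)}$ has the set of truth-values $A_{(n,k)}=\{F_0,\dots,F_n,T_0,\dots,T_k\}$ ($n+k+2$ distinct elements), the set of designated values $D_{(n,k)}=\{T_0,\dots,T_k\}$, and the operations: $\neg F_0=T_0$, $\neg T_0=F_0$, $\neg F_r=F_{r-1}$ for $1\le r\le n$, $\neg T_i=T_{i-1}$ for $1\le i\le k$; $A\rightarrow B=F_0$ if $A\in D_{(n,k)}$ and $B\notin D_{(n,k)}$, and $A\rightarrow B=T_0$ otherwise. An $M_{(n,k)}$-valuation is a homomorphism $v:L(C)\to A_{(n,k)}$. $\Gamma\models_{(n,k)}\phi$ means: for every $M_{(n,k)}$-valuation $v$, $v(\Gamma)\subseteq D_{(n,k)}$ implies $v(\phi)\in D_{(n,k)}$. Secondary connectives (abbreviations in $L(C)$): $\copyright\phi:=(\phi\rightarrow\phi)\rightarrow\phi$; $\sim\phi:=\neg(\copyright\phi)$; $\phi\vee\psi:=\,\sim\phi\rightarrow\psi$; $\phi\wedge\psi:=\,\sim(\phi\rightarrow\sim\psi)$;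 $\phi^{\ast}:=\neg\phi\vee\phi$; $\phi^{\circ}:=\neg(\neg\phi\wedge\phi)$; $\neg^q\phi$ is $\phi$ preceded by $q$ negations ($\neg^0\phi=\phi$). Axiomatics. $\vdash_{(n,k)}$ is the Hilbert-style consequence relation ($\Gamma\vdash_{(n,k)}\phi$ iff there is a finite formal proof of $\phi$ from hypotheses in $\Gamma$) whose only inference rule is Modus Ponens (from $\phi$ and $\phi\rightarrow\psi$ infer $\psi$) and whose axiom schemas are: $Ax_1$: $\phi\rightarrow(\psi\rightarrow\phi)$; $Ax_2$: $(\phi\rightarrow(\psi\rightarrow\theta))\rightarrow((\phi\rightarrow\psi)\rightarrow(\phi\rightarrow\theta))$; $Ax_3$: $(\phi\rightarrow\psi)^{\ast}$; $Ax_4$: $(\phi\rightarrow\psi)^{\circ}$; $Ax_5$: $(\neg^n\phi)^{\ast}$; $Ax_6$: $(\neg^k\phi)^{\circ}$; $Ax_7$: $\phi^{\ast}\rightarrow[\psi^{\circ}\rightarrow((\neg\phi\rightarrow\neg\psi)\rightarrow((\neg\phi\rightarrow\psi)\rightarrow\phi))]$; $Ax_8$: $\phi^{\ast}\rightarrow[\psi^{\circ}\rightarrow((\phi\rightarrow\neg\psi)\rightarrow((\phi\rightarrow\psi)\rightarrow\neg\phi))]$; $Ax_9$: $\phi^{\ast}\rightarrow(\neg\neg\phi\rightarrow\phi)$; $Ax_{10}$: $\phi^{\circ}\rightarrow(\phi\rightarrow\neg\neg\phi)$; $Ax_{11}$: $\phi^{\ast}\rightarrow(\neg\phi)^{\ast}$;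 $Ax_{12}$: $\phi^{\circ}\rightarrow(\neg\phi)^{\circ}$. *)

(* Defs.v *)
From mathcomp Require Import all_boot.
From mathcomp Require Import classical_sets.

Set Implicit Arguments.
Unset Strict Implicit.
Unset Printing Implicit Defensive.

Local Open Scope classical_set_scope.

Inductive form (V : Type) : Type :=
| Atom of V
| Neg of form V
| Imp of form V & form V.

Declare Scope form_scope.
Delimit Scope form_scope with form.
Bind Scope form_scope with form.

Notation "¬ f" := (Neg f) (at level 35, right associativity) : form_scope.
Notation "f ⊃ g" := (Imp f g) (at level 65, right associativity) : form_scope.

Section SecondaryConnectives.
Variable V : Type.
Implicit Types f g : form V.
Local Open Scope form_scope.

Definition copyr f : form V := (f ⊃ f) ⊃ f.
Definition sneg f : form V := ¬ copyr f.
Definition disjf f g : form V := sneg f ⊃ g.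
Definition conjf f g : form V := sneg (f ⊃ sneg g).
Definition star f : form V := disjf (¬ f) f.
Definition circ f : form V := ¬ (conjf (¬ f) f).
Definition negn (q : nat) f : form V := iter q (@Neg V) f.

End SecondaryConnectives.

Section Matrix.
Variables n k : nat.

Inductive tval : Type :=
| Fval of 'I_n.+1
| Tval of 'I_k.+1.

Definition designated (a : tval) : bool :=
  if a is Tval _ then true else false.

Definition Dset : set tval := [set a | designated a].

(* The calls to [inord] are always in range: r.-1 <= n and i.-1 <= k. *)
Definition mneg (a : tval) : tval :=
  match a with
  | Fval r => if r == ord0 then Tval ord0 else Fval (inord r.-1)
  | Tval i => if i == ord0 then Fval ord0 else Tval (inord i.-1)
  end.

Definition mimp (a b : tval) : tval :=
  if designated a && ~~ designated b then Fval ord0 else Tval ord0.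

Definition valuation (V : Type) (v : form V -> tval) : Prop :=
  (forall f, v (Neg f) = mneg (v f)) /\
  (forall f g, v (Imp f g) = mimp (v f) (v g)).

End Matrix.

Definition entails (V : Type) (n k : nat) (Gamma : set (form V))
    (phi : form V) : Prop :=
  forall v : form V -> tval n k, valuation v ->
    v @` Gamma `<=` @Dset n k -> @Dset n k (v phi).

Section Hilbert.
Variables (V : Type) (n k : nat).
Local Open Scope form_scope.

Inductive axiom : form V -> Prop :=
| Ax1 f g : axiom (f ⊃ (g ⊃ f))
| Ax2 f g h : axiom ((f ⊃ (g ⊃ h)) ⊃ ((f ⊃ g) ⊃ (f ⊃ h)))
| Ax3 f g : axiom (star (f ⊃ g))
| Ax4 f g : axiom (circ (f ⊃ g))
| Ax5 f : axiom (star (negn n f))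
| Ax6 f : axiom (circ (negn k f))
| Ax7 f g : axiom (star f ⊃ (circ g ⊃ ((¬ f ⊃ ¬ g) ⊃ ((¬ f ⊃ g) ⊃ f))))
| Ax8 f g : axiom (star f ⊃ (circ g ⊃ ((f ⊃ ¬ g) ⊃ ((f ⊃ g) ⊃ ¬ f))))
| Ax9 f : axiom (star f ⊃ (¬ ¬ f ⊃ f))
| Ax10 f : axiom (circ f ⊃ (f ⊃ ¬ ¬ f))
| Ax11 f : axiom (star f ⊃ star (¬ f))
| Ax12 f : axiom (circ f ⊃ circ (¬ f)).

(* Each entry of s is an axiom, a hypothesis, or follows from two strictly
   earlier entries by modus ponens. *)
Definition formal_proof (Gamma : set (form V)) (s : seq (form V)) : Prop :=
  forall (i : nat) (f : form V), onth s i = Some f ->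
    [\/ axiom f, Gamma f |
        exists (j l : nat) (g : form V),
          [/\ (j < i)%N, (l < i)%N, onth s j = Some g &
              onth s l = Some (g ⊃ f)]].

Definition derives (Gamma : set (form V)) (phi : form V) : Prop :=
  exists s : seq (form V), formal_proof Gamma (rcons s phi).

End Hilbert.

(* Main.v *)
(** Only designatedness of truth values matters: the map sending a
    formula to "its value is designated" is a two-valued function [m] that is
    classical on implications and satisfies the "flip" law: if negating [f]
    changes [m f], then negating once more restores it.  Conversely the value
    of [f] can be recovered from such an [m] by counting how many negations
    are needed before [m] changes.  Soundness and completeness are therefore
    proved for bivaluations.  For completeness, [(f ⊃ f) ⊃ f] is
    interderivable with [f] but, being an implication, it is well-behaved; this
    gives Peirce's law for all formulas, so that derivability from a set that
    is maximal among those not deriving [phi] is a bivaluation. *)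
Require Import Defs.
From mathcomp Require Import all_boot.
From mathcomp Require Import boolp classical_sets.
(* Imported again because MathComp shadows [axiom], [negn] and [tval]. *)
Import Defs.

Set Implicit Arguments.
Unset Strict Implicit.
Unset Printing Implicit Defensive.

Local Open Scope classical_set_scope.
Local Open Scope form_scope.

(** * Hilbert derivations: deduction theorem, Peirce's law, maximal extensions *)

Section Provability.
Variables (V : Type) (n k : nat).
Implicit Types (f g h : form V) (G D : set (form V)).

(** Tree-shaped counterpart of [derives], which allows induction on derivations. *)
Inductive prv G : form V -> Prop :=
| prv_ax f : axiom n k f -> prv G f
| prv_hyp f : G f -> prv G f
| prv_mp f g : prv G f -> prv G (f ⊃ g) -> prv G g.

Lemma formal_proof_cat G s t :
  formal_proof n k G s -> formal_proof n k G t -> formal_proof n k G (s ++ t).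
Proof.
move=> Hs Ht i f; rewrite onth_cat; case: ltnP => [lt_is /Hs|le_si /Ht].
  case=> [||[j [l [g [lt_ji lt_li Hj Hl]]]]]; [by constructor 1|by constructor 2|].
  constructor 3; exists j, l, g; split=> //; rewrite onth_cat.
    by rewrite (ltn_trans lt_ji lt_is).
  by rewrite (ltn_trans lt_li lt_is).
case=> [||[j [l [g [lt_ji lt_li Hj Hl]]]]]; [by constructor 1|by constructor 2|].
constructor 3; exists (size s + j), (size s + l), g.
by split; rewrite -?ltn_subRL // onth_cat ltnNge leq_addr /= addKn.
Qed.

Lemma formal_proof_rcons G s f :
  formal_proof n k G s ->
  [\/ axiom n k f, G f | exists j l g,
      onth s j = Some g /\ onth s l = Some (g ⊃ f)] ->
  formal_proof n k G (rcons s f).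
Proof.
have onth_lt (j : nat) g : onth s j = Some g -> j < size s.
  by move=> Hj; rewrite ltnNge; apply/negP => /onth_default; rewrite Hj.
move=> Hs Hf i g; rewrite -cats1 onth_cat; case: ltnP => [lt_is /Hs|le_si].
  case=> [||[j [l [h [lt_ji lt_li Hj Hl]]]]]; [by constructor 1|by constructor 2|].
  constructor 3; exists j, l, h; split=> //; rewrite onth_cat.
    by rewrite (ltn_trans lt_ji lt_is).
  by rewrite (ltn_trans lt_li lt_is).
case: (i - size s) => [|d] /=; last by rewrite ?onth_nil; case: d.
case=> <-; case: Hf => [||[j [l [h [Hj Hl]]]]]; [by constructor 1|by constructor 2|].
constructor 3; exists j, l, h; split.
- exact: leq_trans (onth_lt _ _ Hj) le_si.
- exact: leq_trans (onth_lt _ _ Hl) le_si.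
- by rewrite onth_cat (onth_lt _ _ Hj).
- by rewrite onth_cat (onth_lt _ _ Hl).
Qed.

Lemma derivesP G f : derives n k G f <-> prv G f.
Proof.
split=> [[s Hs]|].
  have Hprv i : forall g, onth (rcons s f) i = Some g -> prv G g.
    elim/ltn_ind: i => i IH g /Hs[|| [j [l [h [lt_ji lt_li Hj Hl]]]]].
    - exact: prv_ax.
    - exact: prv_hyp.
    - exact: prv_mp (IH _ lt_ji _ Hj) (IH _ lt_li _ Hl).
  by apply: (Hprv (size s)); rewrite -cats1 onth_cat ltnn subnn.
have nil_proof : formal_proof n k G [::] by case.
elim=> [g axg|g Gg|g h _ [s Hs] _ [t Ht]].
- by exists [::]; apply: formal_proof_rcons => //; constructor 1.
- by exists [::]; apply: formal_proof_rcons => //; constructor 2.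
exists (rcons s g ++ rcons t (g ⊃ h)).
apply: formal_proof_rcons; first exact: formal_proof_cat.
constructor 3; exists (size s), (size (rcons s g) + size t), g; split.
  by rewrite onth_cat size_rcons ltnSn -cats1 onth_cat ltnn subnn.
rewrite onth_cat ltnNge leq_addr /= addKn.
by rewrite -cats1 onth_cat ltnn subnn.
Qed.

Lemma prv_sub G D f : G `<=` D -> prv G f -> prv D f.
Proof.
move=> sGD; elim=> [g|g /sGD|g h _ Hg _ Hgh].
- exact: prv_ax.
- exact: prv_hyp.
- exact: prv_mp Hg Hgh.
Qed.

Lemma prv_weak G f g : prv G g -> prv (f |` G) g.
Proof. by apply: prv_sub => h; right. Qed.

Lemma prv_here G f : prv (f |` G) f.
Proof. by apply: prv_hyp; left. Qed.

Lemma prv_const G f g : prv G g -> prv G (f ⊃ g).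
Proof. by move=> Hg; apply: prv_mp Hg (prv_ax _ (Ax1 n k g f)). Qed.

Lemma prv_id G f : prv G (f ⊃ f).
Proof.
exact: prv_mp (prv_ax _ (Ax1 n k f f))
  (prv_mp (prv_ax _ (Ax1 n k f (f ⊃ f))) (prv_ax _ (Ax2 n k f (f ⊃ f) f))).
Qed.

Lemma deduction G f g : prv (f |` G) g -> prv G (f ⊃ g).
Proof.
elim=> [h axh|h [->|Gh]|h h' _ Hh _ Hhh'].
- exact/prv_const/prv_ax.
- exact: prv_id.
- exact/prv_const/prv_hyp.
- exact: prv_mp Hh (prv_mp Hhh' (prv_ax _ (Ax2 _ _ _ _ _))).
Qed.

Lemma prv_copyr G f : prv G (copyr f) <-> prv G f.
Proof. by split=> [|H]; [apply: prv_mp (prv_id G f)|apply: prv_const]. Qed.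

(* Ax7 needs a well-behaved conclusion, which [copyr h] always is. *)
Lemma prv_explosion G f g h : prv G (f ⊃ g) -> prv G (¬ (f ⊃ g)) -> prv G h.
Proof.
move=> Hp Hnp; apply/prv_copyr.
have := prv_ax G (Ax7 n k (copyr h) (f ⊃ g)).
move/(prv_mp (prv_ax _ (Ax3 _ _ _ _)))/(prv_mp (prv_ax _ (Ax4 _ _ _ _))).
by move/(prv_mp (prv_const _ Hnp))/(prv_mp (prv_const _ Hp)).
Qed.

(** Reductio by Ax7 on the implication [copyr f]: its negation makes [f] explosive, which yields
    [f ⊃ g] and hence [f]. *)
Lemma prv_peirce G f g : prv ((f ⊃ g) |` G) f -> prv G f.
Proof.
move=> /deduction Hf; apply/prv_copyr.
have := prv_ax G (Ax7 n k (copyr f) (copyr f)).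
move/(prv_mp (prv_ax _ (Ax3 _ _ _ _)))/(prv_mp (prv_ax _ (Ax4 _ _ _ _))).
move/(prv_mp (prv_id _ _)) => H; apply: prv_mp H.
apply/deduction/prv_copyr; apply: prv_mp (prv_weak _ Hf); apply: deduction.
apply: (@prv_explosion _ (f ⊃ f) f); last exact/prv_weak/prv_here.
exact/prv_copyr/prv_here.
Qed.

(** The larger of two chain members serves both premises of modus ponens. The first disjunct covers
    the empty chain. *)
Lemma prv_bigcup G (F : set (set (form V))) f :
  total_on F (fun X Y => X `<=` Y) -> prv (G `|` \bigcup_(X in F) X) f ->
  prv G f \/ exists2 X, F X & prv (G `|` X) f.
Proof.
move=> totF; elim=> [g axg|g [Gg|[X FX Xg]]|g h _ IHg _ IHgh].
- by left; apply: prv_ax.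
- by left; apply: prv_hyp.
- by right; exists X => //; apply: prv_hyp; right.
have up X g' : prv G g' -> prv (G `|` X) g' by apply: prv_sub => ?; left.
have upU X Y g' : X `<=` Y -> prv (G `|` X) g' -> prv (G `|` Y) g'.
  by move=> sXY; apply: prv_sub; apply: setUS.
case: IHg IHgh => [Hg|[X FX Hg]] [Hgh|[Y FY Hgh]].
- by left; apply: prv_mp Hgh.
- by right; exists Y => //; apply: prv_mp Hgh; apply: up.
- by right; exists X => //; apply: prv_mp Hg _; apply: up.
right; case: (totF X Y FX FY) => sXY.
  by exists Y => //; apply: prv_mp Hgh; apply: upU Hg.
by exists X => //; apply: prv_mp Hg _; apply: upU Hgh.
Qed.

Lemma lindenbaum G phi : ~ prv G phi ->
  exists D, [/\ G `<=` D, ~ prv D phi &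
                forall f, ~ prv D f -> prv (f |` D) phi].
Proof.
(* Zorn ranges over the sets added to [G], so the empty union is admissible too. *)
move=> nGphi; have [] := @Zorn_bigcup _ (fun A => ~ prv (G `|` A) phi).
  by move=> F sF totF /(prv_bigcup totF)[//|[X /sF]].
move=> A [nAphi maxA]; exists (G `|` A); split=> //.
move=> f nf; apply: contrapT => nphi; apply: (maxA (f |` A)).
  split; first by move=> g; right.
  by move=> sA; apply/nf/prv_hyp; right; apply: sA; left.
by rewrite setUCA.
Qed.

End Provability.

(** * Bivaluations and soundness of the axioms *)

Section Bivaluation.
Variables (V : Type) (n k : nat).
Implicit Types (f g : form V) (m : form V -> bool).

(** [bival_bound] merges Ax5 ([b = true]) and Ax6 ([b = false]). *)
Record bivaluation m : Prop := Bivaluation {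
  bival_imp f g : m (f ⊃ g) = (m f ==> m g);
  bival_neg_imp f g : m (¬ (f ⊃ g)) = ~~ m (f ⊃ g);
  bival_flip f : m (¬ f) != m f -> m (¬ ¬ f) = m f;
  bival_bound b f (q := if b then n else k) :
    (m (negn q.+1 f) == b) || (m (negn q f) == b)
}.

Lemma bival_starE m f : bivaluation m -> m (star f) = m (¬ f) || m f.
Proof.
move=> bm; rewrite /star /disjf /sneg /copyr bival_imp // bival_neg_imp //.
by rewrite !bival_imp //; case: (m (¬ f)); case: (m f).
Qed.

Lemma bival_circE m f : bivaluation m -> m (circ f) = ~~ (m (¬ f) && m f).
Proof.
(* [circ f] is a doubly negated implication, whose first negation flips the value. *)
move=> bm; rewrite /circ /conjf /sneg /copyr bival_flip //.
  rewrite bival_imp // !bival_imp // bival_neg_imp // !bival_imp //.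
  by case: (m (¬ f)); case: (m f).
by rewrite bival_neg_imp //; case: (m _).
Qed.

Lemma bival_axiom m f : bivaluation m -> axiom n k f -> m f.
Proof.
move=> bm; pose E := (bival_imp bm, bival_starE, bival_circE).
case=> {f} [f g|f g h|f g|f g|f|f|f g|f g|f|f|f|f]; rewrite ?E //.
- by case: (m f); case: (m g).
- by case: (m f); case: (m g); case: (m h).
- by rewrite bival_neg_imp // bival_imp // orNb.
- by rewrite bival_neg_imp // bival_imp // andNb.
- by have := bival_bound bm true f; rewrite /= !eqb_id.
- by have := bival_bound bm false f; rewrite /= negb_and !eqbF_neg.
- by case: (m (¬ f)); case: (m f); case: (m (¬ g)); case: (m g).
- by case: (m (¬ f)); case: (m f); case: (m (¬ g)); case: (m g).
(* Each of Ax9 to Ax12 could fail only at values of [f], [¬ f], [¬ ¬ f] that the flip law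
   forbids. *)
- by have := @bival_flip m bm f; case: (m (¬ ¬ f));
    case: (m (¬ f)); case: (m f) => // /(_ isT).
- by have := @bival_flip m bm f; case: (m (¬ ¬ f));
    case: (m (¬ f)); case: (m f) => // /(_ isT).
- by have := @bival_flip m bm f; case: (m (¬ ¬ f));
    case: (m (¬ f)); case: (m f) => // /(_ isT).
- by have := @bival_flip m bm f; case: (m (¬ ¬ f));
    case: (m (¬ f)); case: (m f) => // /(_ isT).
Qed.

Lemma bival_prv m G f :
  bivaluation m -> (forall g, G g -> m g) -> prv n k G f -> m f.
Proof.
move=> bm mG; elim=> [g|//|g h _ mg _]; first exact: bival_axiom.
by rewrite bival_imp // mg.
Qed.

(** * From matrix valuations to bivaluations *)

Lemma mneg_flip (a : tval n k) :
  designated (mneg a) != designated a -> designated (mneg (mneg a)) = designated a.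
Proof. by case: a => i /=; case: (i =P ord0) => //= _; rewrite eqxx. Qed.

Definition depth (a : tval n k) : nat :=
  match a with Fval r => r | Tval i => i end.

Lemma depth_le a : depth a <= if designated a then k else n.
Proof. by case: a => i /=; rewrite -ltnS. Qed.

Lemma mneg_depth0 a : depth a = 0 -> designated (mneg a) = ~~ designated a.
Proof. by case: a => i /= i0; rewrite -val_eqE /= i0. Qed.

Lemma mneg_depthS a d : depth a = d.+1 ->
  designated (mneg a) = designated a /\ depth (mneg a) = d.
Proof.
by case: a => i /= iS; have := ltn_ord i;
  rewrite -val_eqE /= iS /= => lt_d; rewrite inordK // ltnW.
Qed.

Lemma mneg_bound b (a : tval n k) (q := if b then n else k) :
  (designated (iter q.+1 (@mneg n k) a) == b) ||
  (designated (iter q (@mneg n k) a) == b).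
Proof.
(* By the flip law, once [b] occurs in a pair of consecutive iterates, it occurs in every later
   pair. *)
have persist p a' : (designated (mneg a') == b) || (designated a' == b) ->
    (designated (iter p.+1 (@mneg n k) a') == b) ||
    (designated (iter p (@mneg n k) a') == b).
  elim: p => [//|p IH] /IH /=; have := @mneg_flip (iter p (@mneg n k) a').
  by case: (designated (mneg (mneg _))); case: (designated (mneg _));
    case: (designated (iter _ _ _)); case: b {IH q} => // /(_ isT).
have [eq_b|neq_b] := eqVneq (designated a) b.
  by apply: persist; rewrite eq_b eqxx orbT.
(* When the designation of [a] is not [b], [q] is the bound from [depth_le], so a flip occurs within
   [q.+1] negations. *)
have : depth a <= q.
  move: (depth_le a) neq_b; rewrite /q.
  by case: (designated a); case: b {persist q}.
elim: q a {neq_b} => [|q IH] a le_aq; case Da: (depth a) => [|d].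
- by apply: persist; rewrite mneg_depth0 //; case: (designated a); case: b.
- by rewrite Da in le_aq.
- by apply: persist; rewrite mneg_depth0 //; case: (designated a); case: b {IH}.
rewrite (iterSr q.+1 _ a) (iterSr q _ a); apply: IH.
by have [_ ->] := mneg_depthS Da; rewrite -ltnS -Da.
Qed.

Lemma designated_bival (v : form V -> tval n k) :
  valuation v -> bivaluation (fun f => designated (v f)).
Proof.
move=> [vN vI].
have vIE f g : designated (v (f ⊃ g)) = (designated (v f) ==> designated (v g)).
  by rewrite vI /mimp; case: (designated (v f)); case: (designated (v g)).
have vneg q f : v (negn q f) = iter q (@mneg n k) (v f).
  by elim: q => //= q <-; rewrite vN.
split=> // [f g|f|b f].
- by rewrite vN vI /mimp; case: ifP.
- by rewrite !vN; apply: mneg_flip.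
- by rewrite /= !vN !vneg; apply: mneg_bound.
Qed.

(** * From bivaluations to matrix valuations *)

Section ValuationOfBivaluation.
Variable m : form V -> bool.
Hypothesis bm : bivaluation m.

(** A constant sequence of values would violate [bival_bound] at [b = ~~ m f]. *)
Lemma flip_ex f : exists i, m (negn i.+1 f) != m f.
Proof.
apply: contrapT => noflip.
have const i : m (negn i f) = m f.
  by case: i => [//|i]; apply/eqP/negP => /negP ?; apply: noflip; exists i.
by have := bival_bound bm (~~ m f) f; cbv zeta; rewrite !const; case: (m f).
Qed.

Definition flip_time f : nat := ex_minn (flip_ex f).

Lemma flip_timeP f i : m (negn i.+1 f) != m f ->
  (forall j, j < i -> m (negn j.+1 f) = m f) -> flip_time f = i.
Proof.
move=> flip_i const_i; rewrite /flip_time; case: ex_minnP => d flip_d min_d.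
apply/eqP; rewrite eqn_leq min_d //= leqNgt; apply/negP => /const_i/eqP.
exact/negP.
Qed.

Lemma flip_time_le f : flip_time f <= if m f then k else n.
Proof.
rewrite /flip_time; case: ex_minnP => d _ min_d.
have := bival_bound bm (~~ m f) f; cbv zeta; set q := if _ then _ else _.
have -> : (if m f then k else n) = q by rewrite /q; case: (m f).
have flipP b : (b == ~~ m f) = (b != m f) by case: b; case: (m f).
(* A change at [negn q.+1 f] bounds the time by [q]; one at [negn q f] forces [q > 0] and gives even
   [q.-1]. *)
rewrite !flipP => /orP[/min_d //|]; case: q => [|q]; first by rewrite eqxx.
by move=> /min_d /leqW.
Qed.

Definition bival_val f : tval n k :=
  if m f then Tval n (inord (flip_time f)) else Fval k (inord (flip_time f)).

Lemma designated_val f : designated (bival_val f) = m f.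
Proof. by rewrite /bival_val; case: (m f). Qed.

Lemma bival_valuation : valuation bival_val.
Proof.
split=> [f|f g].
  have := flip_time_le f; rewrite {2}/bival_val; case Df: (flip_time f) => [|d] led.
    have flip_f : m (¬ f) != m f.
      by move: Df; rewrite /flip_time; case: ex_minnP => d + _ d0; rewrite d0.
    (* Index 0 is sent by [mneg] to index 0 on the other side; the flip law matches this. *)
    have Dnf : flip_time (¬ f) = 0.
      by apply: flip_timeP => //; rewrite /= (bival_flip bm flip_f) eq_sym.
    rewrite /bival_val Dnf; move: flip_f.
    by case: (m f); case: (m (¬ f)) => //= _; rewrite -val_eqE /= inordK //=;
      congr (_ _); apply: val_inj; rewrite /= inordK.
  have [flip_f const_f] : m (negn d.+2 f) != m f /\
      forall j, j <= d -> m (negn j.+1 f) = m f.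
    move: Df; rewrite /flip_time; case: ex_minnP => e flip_e min_e De.
    rewrite -De; split=> // j le_jd; apply/eqP/negP => /negP /min_e.
    by rewrite De ltnNge le_jd.
  have mNf : m (¬ f) = m f := const_f 0 (leq0n d).
  (* Away from 0, a negation uses up one step, just as [mneg] lowers the index. *)
  have Dnf : flip_time (¬ f) = d.
    apply: flip_timeP => [|j lt_jd]; rewrite mNf /negn -iterSr //.
    exact: (const_f j.+1 lt_jd).
  rewrite /bival_val mNf Dnf; move: led; case: (m f) => led /=;
    by rewrite -val_eqE /= inordK.
have flip_fg : flip_time (f ⊃ g) = 0.
  by apply: flip_timeP => //=; rewrite bival_neg_imp //; case: (m _).
rewrite /mimp !designated_val {1}/bival_val flip_fg bival_imp //.
by case: (m f); case: (m g) => /=; congr (_ _); apply: val_inj; rewrite /= inordK.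
Qed.

End ValuationOfBivaluation.

(** * Maximal sets as bivaluations, and completeness *)

Lemma saturated_bival D phi :
  ~ prv n k D phi -> (forall f, ~ prv n k D f -> prv n k (f |` D) phi) ->
  bivaluation (fun f => `[< prv n k D f >]).
Proof.
move=> nphi sat; pose m f := `[< prv n k D f >].
have ax f : axiom n k f -> m f by move=> axf; apply/asboolP/prv_ax.
have mp f g : m (f ⊃ g) -> m f -> m g.
  by move=> /asboolP Hfg /asboolP Hf; apply/asboolP; apply: prv_mp Hfg.
have imp f g : m (f ⊃ g) = (m f ==> m g).
  apply/idP/implyP => [/mp //|Hfg].
  apply/negPn/negP => /asboolP /sat /deduction Hfgphi.
  case: (boolP (m f)) => [/Hfg /asboolP Hg|/asboolP /sat /deduction Hfphi].
    by apply: nphi; apply: prv_mp Hfgphi; apply: prv_const.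
  (* Under [phi ⊃ g], [f ⊃ phi] gives [f ⊃ g] and so [phi]; Peirce's law discharges the
     assumption. *)
  apply/nphi/(@prv_peirce _ _ _ _ _ g); apply: prv_mp (prv_weak _ Hfgphi).
  apply: deduction; apply: prv_mp (prv_weak _ (prv_here _ _ _ _)).
  by apply: prv_mp (prv_here _ _ _ _) _; do 2!apply: prv_weak.
have neg_imp f g : m (¬ (f ⊃ g)) = ~~ m (f ⊃ g).
  apply/idP/idP => [/asboolP Hn|nfg].
    by apply/negP => /asboolP H; apply: nphi; apply: prv_explosion H Hn.
  (* An underivable implication implies everything, so Ax8 delivers its negation. *)
  have impP h : m ((f ⊃ g) ⊃ h) by rewrite imp (negPf nfg).
  have := ax _ (Ax8 n k (f ⊃ g) (f ⊃ g)).
  move/mp/(_ (ax _ (Ax3 _ _ f g)))/mp/(_ (ax _ (Ax4 _ _ f g))).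
  by move/mp/(_ (impP _))/mp/(_ (impP _)).
have starE f : m (star f) = m (¬ f) || m f.
  by rewrite /star /disjf /sneg /copyr imp neg_imp !imp; case: (m (¬ f)); case: (m f).
have circE f : m (circ f) = ~~ (m (¬ f) && m f).
  have dneg g h : m (¬ ¬ (g ⊃ h)) = m (g ⊃ h).
    apply/idP/idP.
      exact: (mp _ _ (mp _ _ (ax _ (Ax9 _ _ _)) (ax _ (Ax3 _ _ _ _)))).
    exact: (mp _ _ (mp _ _ (ax _ (Ax10 _ _ _)) (ax _ (Ax4 _ _ _ _)))).
  rewrite /circ /conjf /sneg /copyr dneg !imp neg_imp !imp.
  by case: (m (¬ f)); case: (m f).
split=> // [f|[] f].
(* If [f] and [¬ f] differ in value, [star f] and [circ f] both hold, so Ax9 and Ax10 give the flip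
   law. *)
- have := ax _ (Ax9 n k f); have := ax _ (Ax10 n k f).
  rewrite -!/(m _) !(imp, starE, circE).
  by case: (m (¬ f)); case: (m f); case: (m (¬ ¬ f)).
- by have := ax _ (Ax5 n k f); rewrite starE /= !eqb_id.
- by have := ax _ (Ax6 n k f); rewrite circE negb_and /= !eqbF_neg.
Qed.

End Bivaluation.

Theorem theorem4p6 (V : countType) (n k : nat) (Gamma : set (form V))
    (phi : form V) :
  entails n k Gamma phi <-> derives n k Gamma phi.
Proof.
rewrite derivesP; split=> [Hphi|Hphi v val_v Gv].
  apply: contrapT => /lindenbaum [D [sGD nphi sat]].
  have bm := saturated_bival nphi sat.
  (* This valuation designates exactly the formulas derivable from [D]. *)
  have := Hphi _ (bival_valuation bm).
  rewrite /Dset /= designated_val => H; apply: nphi; apply/asboolP/H.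
  move=> _ [f Gf <-] /=; rewrite designated_val.
  exact/asboolP/prv_hyp/sGD.
apply: (bival_prv (designated_bival val_v) _ Hphi) => f Gf.
by apply: (Gv (v f)); exists f.
Qed.
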